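(* Let $R=k[x_1,\dots,x_n]$ be a standard graded polynomial ring over a field $k$, and let $I=(f_1,\dots,f_p)$ where $f_1,\dots,f_p$ is a regular sequence of homogeneous elements of $R$ (so $R/I$ is a complete intersection). Then the Betti diagram $\beta(R/I)$ is a non-negative rational linear combination of pure diagrams of codimension $p$.
   Context: All $R$-modules are finitely generated and graded, each $x_i$ having degree one. The Betti diagram $\beta(M)$ of an $R$-module $M$ is the matrix with entries $\beta(M)_{i,j}=\beta_{i,j}(M)$, where the minimal free resolution of $M$ is $0\to\bigoplus_j R(-j)^{\beta_{p,j}}\to\dots\to\bigoplus_j R(-j)^{\beta_{0,j}}\to M\to0$. For a strictly increasing integer sequence $d=(d_0,\dots,d_p)$, the pure diagram $\pi(d)$ (of codimension $p$) is the matrix with $\pi(d)_{i,j}=0$ for $j\ne d_i$, $\pi(d)_{0,d_0}=1$, and $\pi(d)_{i,d_i}=(-1)^{i+1}\prod_{1\le k\le p,\,k\ne i}\frac{d_k-d_0}{d_k-d_i}$ for $1\le i\le p$. *)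

(* Defs.v *)
From HB Require Import structures.
From Stdlib Require Import ClassicalEpsilon.
From mathcomp Require Import all_boot all_order all_algebra.
From mathcomp Require Import boolp mpoly.

Set Implicit Arguments.
Unset Strict Implicit.
Unset Printing Implicit Defensive.

Import Order.TTheory GRing.Theory Num.Theory.

Local Open Scope ring_scope.
Local Open Scope quotient_scope.

Section Ideal.
Variable R : comNzRingType.

Definition ideal (s : seq R) : pred R := fun r =>
  `[< exists c : 'I_(size s) -> R, r = \sum_(i < size s) c i * s`_i >].

Lemma idealP (s : seq R) (r : R) :
  reflect (exists c : 'I_(size s) -> R, r = \sum_(i < size s) c i * s`_i)
          (r \in ideal s).
Proof. exact: asboolP. Qed.

Lemma ideal_zmod_closed s : zmod_closed (ideal s).
Proof.
split=> [|_ _ /idealP[c ->] /idealP[e ->]].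
  by apply/idealP; exists (fun=> 0); rewrite big1 // => i _; rewrite mul0r.
apply/idealP; exists (fun i => c i - e i).
by rewrite -sumrB; apply: eq_bigr => i _; rewrite mulrBl.
Qed.

HB.instance Definition _ (s : seq R) :=
  GRing.isZmodClosed.Build R (ideal s) (ideal_zmod_closed s).

Lemma idealMl s a r : r \in ideal s -> a * r \in ideal s.
Proof.
case/idealP=> c ->; apply/idealP; exists (fun i => a * c i).
by rewrite mulr_sumr; apply: eq_bigr => i _; rewrite mulrA.
Qed.

Definition ideal_zmod (s : seq R) : zmodClosed R :=
  GRing.ZmodClosed.clone R (ideal s) _.

(* The cyclic R-module R/(s); it is the zero module when s generates R. *)
Definition quo (s : seq R) := Quotient.quot (ideal_zmod s).

HB.instance Definition _ (s : seq R) := GRing.Zmodule.on (quo s).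

Definition quo_pi (s : seq R) (r : R) : quo s :=
  \pi_(quo s) r.

Definition quo_scale (s : seq R) (a : R) (x : quo s) : quo s :=
  quo_pi s (a * repr x).

Lemma quo_piP s r t : reflect (quo_pi s r = quo_pi s t) (r - t \in ideal s).
Proof. by rewrite Quotient.idealrBE; apply: eqP. Qed.

Lemma quo_piK s (x : quo s) :
  quo_pi s (repr x) = x.
Proof. exact: reprK. Qed.

Lemma quo_pi_zmod_morphism s : zmod_morphism (quo_pi s).
Proof. by move=> r t; rewrite /quo_pi raddfB. Qed.

HB.instance Definition _ (s : seq R) :=
  GRing.isZmodMorphism.Build R (quo s) (quo_pi s) (@quo_pi_zmod_morphism s).

Lemma quo_scale_pi s a r : quo_scale a (quo_pi s r) = quo_pi s (a * r).
Proof.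
apply/quo_piP; rewrite -mulrBr; apply: idealMl.
by apply/quo_piP; rewrite quo_piK.
Qed.

Lemma quo_scaleA s a b (x : quo s) :
  quo_scale a (quo_scale b x) = quo_scale (a * b) x.
Proof. by rewrite -[x]quo_piK !quo_scale_pi mulrA. Qed.

Lemma quo_scale1 s : left_id 1 (@quo_scale s).
Proof. by move=> x; rewrite -[x]quo_piK quo_scale_pi mul1r. Qed.

Lemma quo_scaleDr s : right_distributive (@quo_scale s) +%R.
Proof.
move=> a x y; rewrite -[x]quo_piK -[y]quo_piK -raddfD !quo_scale_pi.
by rewrite mulrDr raddfD.
Qed.

Lemma quo_scaleDl s (x : quo s) :
  {morph (fun a => quo_scale a x) : a b / a + b}.
Proof. by move=> a b; rewrite -[x]quo_piK !quo_scale_pi mulrDl raddfD. Qed.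

HB.instance Definition _ (s : seq R) :=
  GRing.Zmodule_isLmodule.Build R (quo s)
    (@quo_scaleA s) (@quo_scale1 s) (@quo_scaleDr s) (@quo_scaleDl s).

Definition regular_sequence (s : seq R) : Prop :=
  (forall i : nat, (i < size s)%N ->
     forall x : quo (take i s), s`_i *: x = 0 -> x = 0)
  /\ 1 \notin ideal s.

End Ideal.

Section Graded.
Variables (k : fieldType) (n : nat).
Local Notation R := {mpoly k[n]}.

Definition poly_gr (j : int) (r : R) : Prop :=
  match j with Posz d => r \is d.-homog | Negz _ => r = 0 end.

Definition is_grading (M : lmodType R) (gr : int -> M -> Prop) : Prop :=
  [/\ forall j, gr j 0 /\ (forall x y, gr j x -> gr j y -> gr j (x - y)),
      forall d j (r : R) x, poly_gr d r -> gr j x -> gr (d + j) (r *: x),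
      forall x, exists (s : seq int) (c : int -> M),
        (forall j, gr j (c j)) /\ x = \sum_(j <- s) c j
    & forall (s : seq int) (c : int -> M), uniq s -> (forall j, gr j (c j)) ->
        \sum_(j <- s) c j = 0 -> {in s, forall j, c j = 0}].

Definition quo_gr (s : seq R) (j : int) (x : quo s) : Prop :=
  exists2 r : R, poly_gr j r & x = quo_pi s r.

Definition poly_proj (j : int) (r : R) : R :=
  match j with Posz d => pihomog mdeg d r | Negz _ => 0 end.

Lemma poly_proj_sum (I : eqType) (j : int) (u : seq I) (F : I -> R) :
  poly_proj j (\sum_(i <- u) F i) = \sum_(i <- u) poly_proj j (F i).
Proof. by case: j => d /=; [rewrite raddf_sum | rewrite big1]. Qed.

Lemma poly_proj_gr (j l : int) (r : R) :
  poly_gr j r -> poly_proj l r = if l == j then r else 0.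
Proof.
case: j => [d|d] /= hr; last first.
  by rewrite hr if_same; case: l => e //=; rewrite raddf0.
case: l => [e|e] //=; case: eqP => [[->]|ne]; first exact: pihomog_dE.
by apply: pihomog_ne0 hr; apply/eqP => de; apply: ne; rewrite de.
Qed.

Lemma poly_proj_ideal (s : seq R) (j : int) (r : R) :
  (forall i, (i < size s)%N -> s`_i \is homog mdeg) ->
  r \in ideal s -> poly_proj j r \in ideal_zmod s.
Proof.
move=> hs /idealP[c ->]; case: j => [d|d] /=; last exact: rpred0.
rewrite raddf_sum; apply: rpred_sum => i _.
have /homogP[e se] := hs i (ltn_ord i).
rewrite [c i](pihomog_partitionE (mf := mdeg) (leqnn _)) mulr_suml raddf_sum.
apply: rpred_sum => b _ /=.
have hb : pihomog mdeg b (c i) * s`_i \is (b + e).-homog.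
  by apply: dhomogM => //; exact: pihomogP.
have [<-|ne] := eqVneq (b + e)%N d; last first.
  by rewrite (pihomog_ne0 ne hb); exact: rpred0.
rewrite pihomog_dE //; apply: idealMl; apply/idealP.
exists (fun l => (l == i)%:R); rewrite (bigD1 i) //= eqxx mul1r big1 ?addr0 //.
by move=> l /negbTE ->; rewrite mul0r.
Qed.

Lemma quo_grading (s : seq R) :
  (forall i, (i < size s)%N -> s`_i \is homog mdeg) -> is_grading (@quo_gr s).
Proof.
move=> hs; split.
- move=> j; split.
    exists 0; first by case: j => [d|d] //=; exact: dhomog0.
    by rewrite raddf0.
  move=> _ _ [r hr ->] [t ht ->]; exists (r - t); last by rewrite raddfB.
  by case: j hr ht => [d|d] /=; [exact: rpredB | move=> -> ->; rewrite subr0].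
- move=> d j a _ ha [r hr ->]; exists (a * r); last exact: quo_scale_pi.
  case: d ha => [d|d] /= ha; last first.
    by rewrite ha mul0r; case: (_ + j) => e //=; exact: dhomog0.
  case: j hr => [e|e] /= hr; first exact: dhomogM.
  by rewrite hr mulr0; case: (_ + _) => e' //=; exact: dhomog0.
- move=> x; pose r := repr (x : Quotient.quot (ideal_zmod s)).
  exists (map Posz (iota 0 (msize r))), (fun j => quo_pi s (poly_proj j r)); split.
    move=> j; exists (poly_proj j r) => //.
    by case: j => d //=; exact: pihomogP.
  rewrite -[LHS]quo_piK -/r big_map /=.
  rewrite {1}[r](pihomog_partitionE (mf := mdeg) (leqnn _)) raddf_sum /=.
  by rewrite -[in RHS](subn0 (msize r)) -/(index_iota 0 _) big_mkord.
- move=> u c uu hc cu0 j ju.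
  have /choice[r hr] : forall l, exists r, poly_gr l r /\ c l = quo_pi s r.
    by move=> l; have [r hr cr] := hc l; exists r.
  have ru : \sum_(l <- u) r l \in ideal s.
    rewrite -[X in X \in _]subr0; apply/quo_piP.
    rewrite raddf0 raddf_sum -[RHS]cu0.
    by apply: eq_bigr => l _; rewrite (hr l).2.
  have := poly_proj_ideal j hs ru; rewrite poly_proj_sum.
  rewrite (bigD1_seq j) //= (poly_proj_gr _ (hr j).1) eqxx big1 => [|l lj].
    rewrite addr0 (hr j).2 => rj.
    by rewrite -[RHS](raddf0 (quo_pi s)); apply/quo_piP; rewrite subr0.
  by rewrite (poly_proj_gr _ (hr l).1) eq_sym (negbTE lj).
Qed.

(* The grading of the free module \bigoplus_t R(-a t). *)
Definition free_gr (m : nat) (a : 'I_m -> int) (j : int) (v : 'rV[R]_m) : Prop :=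
  forall t, poly_gr (j - a t) (v 0 t).

(* The irrelevant ideal (x_1, ..., x_n). *)
Definition max_ideal : pred R := ideal [seq 'X_i | i <- enum 'I_n].

(* The i-th free module is \bigoplus_(t < rk i) R(- shift t); minimality is  *)
(* diff_min: the image of each differential lies in max_ideal times the next *)
(* free module.                                                              *)
Record min_free_resolution (M : lmodType R) (gr : int -> M -> Prop) := {
  rk : nat -> nat;
  shift : forall i, 'I_(rk i) -> int;
  diff : forall i, {linear 'rV[R]_(rk i.+1) -> 'rV[R]_(rk i)};
  aug : {linear 'rV[R]_(rk 0) -> M};
  rk_finite : exists l, forall i, (l < i)%N -> rk i = 0%N;
  diff_gr : forall i j v, free_gr (@shift i.+1) j v ->
    free_gr (@shift i) j (diff i v);
  aug_gr : forall j v, free_gr (@shift 0) j v -> gr j (aug v);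
  aug_surj : forall x, exists v, aug v = x;
  aug_exact : forall v, aug v = 0 <-> exists w, diff 0 w = v;
  diff_exact : forall i v, diff i v = 0 <-> exists w, diff i.+1 w = v;
  diff_min : forall i v t, diff i v 0 t \in max_ideal
}.

Definition res_betti (M : lmodType R) (gr : int -> M -> Prop)
    (F : min_free_resolution gr) (i : nat) (j : int) : nat :=
  #|[set t : 'I_(rk F i) | shift t == j]|.

(* Minimal resolutions being unique up to isomorphism, all of them have the   *)
(* same res_betti; the value is unspecified if there is no finite resolution. *)
Definition betti (M : lmodType R) (gr : int -> M -> Prop) : nat -> int -> nat :=
  epsilon (inhabits (fun _ _ => 0%N)) (fun b =>
    exists F : min_free_resolution gr, forall i j, b i j = res_betti F i j).

End Graded.

Definition increasing (p : nat) (d : 'I_p.+1 -> int) : Prop :=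
  forall a b : 'I_p.+1, (a < b)%N -> d a < d b.

Definition pure_diagram (p : nat) (d : 'I_p.+1 -> int) (i : nat) (j : int) : rat :=
  if insub i is Some a then
    if j != d a then 0 else
    if a == ord0 then 1 else
    (-1) ^+ i.+1 * \prod_(b : 'I_p.+1 | (b != ord0) && (b != a))
      ((d b - d ord0)%:~R / (d b - d a)%:~R)
  else 0.

(* Main.v *)
Require Import Defs.
From mathcomp Require Import all_boot all_order all_algebra.
From mathcomp Require Import mpoly.
From HB Require Import structures.
From mathcomp Require Import boolp ring zify.

(** Let a_1, ..., a_p be the degrees of the f_i.  The Koszul complex of f is a
minimal free resolution of the quotient, so its (i, j) Betti number is the
number of i-element subsets S of the generators whose degrees add up to
a(S) = j ([koszul_resolution]).

A p-element ordering w of the generators gives the chain of subsets formed by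
its initial segments S_0, ..., S_p, hence the degree sequence d_i = a(S_i),
strictly increasing because all degrees are positive.  Rescaled by the positive
factor 1 / prod_(b > 0) d_b, the pure diagram of d has the entry
prod_(b != i) 1 / |d_b - d_i| in position (i, d_i).  The theorem follows from
the identity

  prod_x a_x * sum_w (rescaled pure diagram of w) = Betti diagram,

valid entry by entry ([sum_chain_weight]).  For i > 0 the orderings are grouped
by their first letter x: the entry of x w in row i and column j is the entry of
w in row i - 1 and column j - a_x, divided by j.  Induction reduces the claim to
sum_x a_x #{S not containing x, |S| = i - 1, a(S) = j - a_x} = j #{S, |S| = i, a(S) = j},
which counts pairs x in S weighted by a_x.  For i = 0 they are grouped by their
last letter and pairs x outside S are counted instead.

The Betti numbers of the statement are those of an arbitrary minimal free
resolution, so two facts from homological algebra are needed.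
- Existence: the Koszul complex is built by adding one generator g at a time,
  as the mapping cone of multiplication by g on the resolution found so far
  ([cone]).  Exactness in homological degree one is where regularity of g
  enters, and minimality holds because g has no constant term.
- Uniqueness ([res_betti_unique]): comparison maps A, B between two minimal
  resolutions satisfy A B - 1 = D h + h' D' for a homotopy h.  The differentials
  vanish at the origin, so the constant terms of A and B are mutually inverse;
  as A and B are homogeneous these inverses respect the grading of the
  generators, and the numbers of generators of each degree agree. *)

Set Implicit Arguments.
Unset Strict Implicit.
Unset Printing Implicit Defensive.

Import Order.TTheory GRing.Theory Num.Theory.
Local Open Scope ring_scope.

(** * Graded pieces of the polynomial ring and of free modules *)

Section Graded.
Variables (k : fieldType) (n : nat).
Local Notation R := {mpoly k[n]}.

Lemma poly_gr0 j : poly_gr j (0 : R).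
Proof. by case: j => d //=; exact: dhomog0. Qed.

Lemma poly_grD j (r u : R) : poly_gr j r -> poly_gr j u -> poly_gr j (r + u).
Proof. by case: j => d /=; [exact: rpredD | move=> -> ->; rewrite addr0]. Qed.

Lemma poly_grN j (r : R) : poly_gr j r -> poly_gr j (- r).
Proof. by case: j => d /=; [rewrite rpredN | move=> ->; rewrite oppr0]. Qed.

Lemma poly_grM i j (r u : R) : poly_gr i r -> poly_gr j u -> poly_gr (i + j) (r * u).
Proof.
case: i => [d|d] /=; last by move=> -> _; rewrite mul0r; exact: poly_gr0.
case: j => [e|e] /=; last by move=> _ ->; rewrite mulr0; exact: poly_gr0.
exact: dhomogM.
Qed.

Lemma poly_gr_proj j (r : R) : poly_gr j (poly_proj j r).
Proof. by case: j => d //=; exact: pihomogP. Qed.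

Lemma poly_gr_coeff0 j (r : R) : poly_gr j r -> j != 0 -> r@_0%MM = 0.
Proof.
case: j => d /=; last by move=> -> _; rewrite mcoeff0.
by move=> rd d0; apply: (dhomog_nemf_coeff rd); rewrite /= mdeg0 eq_sym.
Qed.

Lemma poly_projE (r : R) (u : seq int) : uniq u ->
  (forall b : nat, (b < msize r)%N -> b%:Z \in u) ->
  \sum_(l <- u) poly_proj l r = r.
Proof.
move=> uu ub; have rE := pihomog_partitionE (mf := mdeg) (leqnn (msize r)).
rewrite [RHS]rE {1}rE.
under eq_bigr do rewrite poly_proj_sum.
rewrite exchange_big; apply: eq_bigr => b _ /=.
have gb : poly_gr b%:Z (pihomog mdeg b r) by exact: pihomogP.
rewrite (bigD1_seq b%:Z) ?ub //= big1 => [|l lb].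
  by rewrite addr0 pihomog_id.
by rewrite (poly_proj_gr _ gb) (negbTE lb).
Qed.

(** Taking homogeneous parts commutes with multiplication by a homogeneous
element.  Degrees are integers, so the case e < 0, where both sides vanish, is
included. *)
Lemma poly_projM (d e : int) (r u : R) : poly_gr d u ->
  poly_proj (e + d) (r * u) = poly_proj e r * u.
Proof.
move=> ud; have rE := pihomog_partitionE (mf := mdeg) (leqnn (msize r)).
rewrite rE mulr_suml !poly_proj_sum mulr_suml; apply: eq_bigr => b _.
have gb : poly_gr b%:Z (pihomog mdeg b r) by exact: pihomogP.
rewrite (poly_proj_gr _ (poly_grM gb ud)) (poly_proj_gr _ gb) (inj_eq (addIr d)).
by case: eqP => // _; rewrite mul0r.
Qed.

(** The two clauses of a grading that give uniqueness of homogeneous parts.  They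
are isolated because this is all that a lift of homogeneous elements requires of
the target, and because they are shared by free modules and by the module being
resolved, so that one lifting lemma serves every step of a resolution. *)
Definition gr_indep (N : lmodType R) (gr : int -> N -> Prop) : Prop :=
  (forall j, gr j 0 /\ (forall x y, gr j x -> gr j y -> gr j (x - y))) /\
  (forall (s : seq int) (c : int -> N), uniq s -> (forall j, gr j (c j)) ->
        \sum_(j <- s) c j = 0 -> {in s, forall j, c j = 0}).

Lemma free_gr_indep m (a : 'I_m -> int) : gr_indep (free_gr (k := k) (n := n) a).
Proof.
split=> [j|u c uu gc c0 j ju].
  split=> [t|x y gx gy t]; rewrite !mxE; first exact: poly_gr0.
  exact/poly_grD/poly_grN/gy/gx.
apply/rowP => t; move/rowP/(_ t): c0.
rewrite summxE mxE => /(congr1 (poly_proj (j - a t))).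
rewrite poly_proj_sum (bigD1_seq j) //= (poly_proj_gr _ (gc j t)) eqxx.
rewrite big1 ?addr0 => [->|l lj]; first by rewrite (poly_proj_gr _ (poly_gr0 0)) if_same.
by rewrite (poly_proj_gr _ (gc l t)) (inj_eq (addIr _)) eq_sym (negbTE lj).
Qed.

Definition component m (a : 'I_m -> int) (l : int) (w : 'rV[R]_m) : 'rV[R]_m :=
  \row_t poly_proj (l - a t) (w 0 t).

Lemma component_gr m (a : 'I_m -> int) l w : free_gr a l (component a l w).
Proof. by move=> t; rewrite mxE; exact: poly_gr_proj. Qed.

Lemma component_sum m (a : 'I_m -> int) (j : int) (w : 'rV[R]_m) :
  exists u : seq int, [/\ uniq u, j \in u & \sum_(l <- u) component a l w = w].
Proof.
pose u := undup (j :: [seq b%:Z + a t | t <- enum 'I_m, b <- iota 0 (msize (w 0 t))]).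
exists u; split; [exact: undup_uniq|by rewrite mem_undup mem_head|].
apply/rowP => t; rewrite summxE.
under eq_bigr do rewrite mxE.
rewrite -(big_map (fun l => l - a t) xpredT (fun l => poly_proj l (w 0 t))).
apply: poly_projE => [|b bw].
  by rewrite map_inj_uniq ?undup_uniq //; exact: addIr.
apply/mapP; exists (b%:Z + a t); last by rewrite addrK.
rewrite mem_undup inE; apply/orP; right; apply/allpairsPdep.
by exists t, b; rewrite mem_enum mem_iota.
Qed.

(** A homogeneous element in the image of a graded map has a homogeneous
preimage: the part of the right degree of any preimage, since the images of the
other parts must cancel. *)
Lemma graded_preimage (N : lmodType R) (gr : int -> N -> Prop) m
    (a : 'I_m -> int) (h : {linear 'rV[R]_m -> N}) (j : int) (w : 'rV[R]_m) :
  gr_indep gr -> (forall l v, free_gr a l v -> gr l (h v)) -> gr j (h w) ->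
  exists2 w', free_gr a j w' & h w' = h w.
Proof.
move=> [gr0 indep] hgr gw; exists (component a j w); first exact: component_gr.
have [u [uu ju wE]] := component_sum a j w.
pose c l := h (component a l w) - (if l == j then h w else 0).
have gc l : gr l (c l).
  apply: (gr0 l).2; first exact/hgr/component_gr.
  by case: eqP => [->//|_]; exact: (gr0 l).1.
have c0 : \sum_(l <- u) c l = 0.
  rewrite sumrB -raddf_sum wE (bigD1_seq j) //= eqxx big1 ?addr0 ?subrr //.
  by move=> l /negbTE ->.
by have := indep u c uu gc c0 j ju; rewrite /c eqxx => /eqP; rewrite subr_eq0 => /eqP.
Qed.

Definition graded_mx m m' (a : 'I_m -> int) (a' : 'I_m' -> int)
  (A : 'M[R]_(m, m')) : Prop := forall s, free_gr a' (a s) (row s A).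

Lemma free_grM m m' (a : 'I_m -> int) (a' : 'I_m' -> int) (A : 'M[R]_(m, m')) j v :
  graded_mx a a' A -> free_gr a j v -> free_gr a' j (v *m A).
Proof.
move=> gA gv t; rewrite mxE; apply: (big_ind (poly_gr (j - a' t))).
- exact: poly_gr0.
- exact: poly_grD.
move=> s _; have := gA s t; rewrite mxE => /(poly_grM (gv s)).
by rewrite addrA subrK.
Qed.

Lemma free_gr_delta m (a : 'I_m -> int) s : free_gr a (a s) (delta_mx 0 s : 'rV[R]_m).
Proof.
move=> t; rewrite mxE /=; case: (eqVneq t s) => [->|_]; last exact: poly_gr0.
by rewrite subrr /=; exact: dhomog1.
Qed.

Lemma graded_lift (N : lmodType R) (gr : int -> N -> Prop) m m'
    (a : 'I_m -> int) (a' : 'I_m' -> int) (h : {linear 'rV[R]_m' -> N})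
    (x : 'I_m -> N) :
  gr_indep gr -> (forall l v, free_gr a' l v -> gr l (h v)) ->
  (forall s, gr (a s) (x s)) -> (forall s, exists w, h w = x s) ->
  exists2 A : 'M[R]_(m, m'), graded_mx a a' A & forall s, h (row s A) = x s.
Proof.
move=> indep hgr gx hx.
have /choice[w Hw] s : exists w, free_gr a' (a s) w /\ h w = x s.
  have [w0 w0x] := hx s.
  have [|w gw wE] := graded_preimage (j := a s) (w := w0) indep hgr.
    by rewrite w0x.
  by exists w; rewrite wE.
exists (\matrix_s w s) => s; rewrite rowK; first exact: (Hw s).1.
exact: (Hw s).2.
Qed.

Lemma linear_rowE m (N : lmodType R) (h : {linear 'rV[R]_m -> N}) v :
  h v = \sum_s v 0 s *: h (delta_mx 0 s).
Proof.
by rewrite {1}(row_sum_delta v) linear_sum; apply: eq_bigr => s _; rewrite linearZ.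
Qed.

(** Projectivity of free modules, without gradings; homotopies need no more. *)
Lemma matrix_lift m m' l (h : {linear 'rV[R]_m' -> 'rV[R]_l}) (B : 'M[R]_(m, l)) :
  (forall s, exists w, h w = row s B) -> exists A, A *m lin1_mx h = B.
Proof.
move/choice => [w Hw]; exists (\matrix_s w s); apply/row_matrixP => s.
by rewrite row_mul rowK mul_rV_lin1.
Qed.

(** * Uniqueness of graded Betti numbers *)

Local Notation const_mx0 := (map_mx (mcoeff (R := k) (n := n) 0%MM)).

Lemma max_ideal_coeff0 (r : R) : r \in @max_ideal k n -> r@_0%MM = 0.
Proof.
case/idealP => c ->; rewrite raddf_sum big1 // => i _.
etransitivity; first exact: (rmorphM (mcoeff 0%MM)).
have im : (i < size (enum 'I_n))%N by rewrite -(size_map (fun i => 'X_i : R)).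
have im' : (i < n)%N by move: im; rewrite size_enum_ord.
by rewrite (nth_map (Ordinal im')) //= mcoeffX mnm1_eq0 mulr0.
Qed.

(** A homogeneous matrix modulo the irrelevant ideal is block diagonal with
respect to the degrees of the generators. *)
Lemma const_mx0_graded m m' (a : 'I_m -> int) (a' : 'I_m' -> int)
    (A : 'M[R]_(m, m')) s t :
  graded_mx a a' A -> a s != a' t -> const_mx0 A s t = 0.
Proof.
move=> gA ne; rewrite mxE; have := gA s t; rewrite mxE => /poly_gr_coeff0; apply.
by rewrite subr_eq0.
Qed.

Lemma const_mx0_1 m : const_mx0 (1%:M : 'M[R]_m) = 1%:M.
Proof. exact: map_mx1. Qed.

Section Compare.
Variables (M : lmodType R) (gr : int -> M -> Prop).
Hypothesis gr_ok : gr_indep gr.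

Local Notation D F i := (lin1_mx (diff F i)).
Local Notation sh F i := (@shift _ _ _ _ F i).

Lemma diff_const0 (F : min_free_resolution gr) i : const_mx0 (D F i) = 0.
Proof.
apply/matrixP => s t; rewrite !mxE; apply: max_ideal_coeff0; exact: diff_min.
Qed.

Lemma diff_sq0 (F : min_free_resolution gr) i : D F i.+1 *m D F i = 0.
Proof.
apply/row_matrixP => s; rewrite row0 row_mul mul_rV_lin1.
by apply/diff_exact; exists (delta_mx 0 s); rewrite rowE mul_rV_lin1.
Qed.

Lemma kernel_lift (F : min_free_resolution gr) i m (B : 'M[R]_(m, rk F i.+1)) :
  B *m D F i = 0 -> exists A, A *m D F i.+1 = B.
Proof.
move=> B0; apply: matrix_lift => s; apply/diff_exact.
by rewrite -mul_rV_lin1 -row_mul B0 row0.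
Qed.

(** Boundaries are used in place of cycles in the hypothesis and in the
conclusion, which makes the step from 0 to 1 the same as the others: it never
mentions the augmentation. *)
Lemma chain_map_step (F G : min_free_resolution gr) i (A : 'M[R]_(rk F i, rk G i)) :
  graded_mx (sh F i) (sh G i) A ->
  (forall w, exists w', diff G i w' = diff F i w *m A) ->
  exists A' : 'M[R]_(rk F i.+1, rk G i.+1),
    [/\ graded_mx (sh F i.+1) (sh G i.+1) A',
        A' *m D G i = D F i *m A
      & forall w, exists w', diff G i.+1 w' = diff F i.+1 w *m A'].
Proof.
move=> gA bA.
have [|s|s|A' gA' A'E] := @graded_lift _ _ _ _ (sh F i.+1)
    (sh G i.+1) (diff G i) (fun s => diff F i (delta_mx 0 s) *m A)
    (@free_gr_indep _ (sh G i)).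
- exact: diff_gr.
- exact/(free_grM gA)/diff_gr/free_gr_delta.
- exact: bA.
have E : A' *m D G i = D F i *m A.
  by apply/row_matrixP => s; rewrite !row_mul mul_rV_lin1 A'E rowE mul_rV_lin1.
exists A'; split=> // w; apply/diff_exact.
rewrite -mul_rV_lin1 -mulmxA E mulmxA mul_rV_lin1.
suff -> : diff F i (diff F i.+1 w) = 0 by rewrite mul0mx.
by apply/diff_exact; exists w.
Qed.

Lemma chain_map_base (F G : min_free_resolution gr) :
  exists A : 'M[R]_(rk F 0, rk G 0),
    [/\ graded_mx (sh F 0) (sh G 0) A,
        forall v, aug G (v *m A) = aug F v
      & forall w, exists w', diff G 0 w' = diff F 0 w *m A].
Proof.
have [|s|s|A gA AE] := @graded_lift _ _ _ _ (sh F 0)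
    (sh G 0) (aug G) (fun s => aug F (delta_mx 0 s)) gr_ok.
- exact: aug_gr.
- apply: aug_gr; exact: free_gr_delta.
- exact: aug_surj.
have E v : aug G (v *m A) = aug F v.
  rewrite (linear_rowE (aug F)) mulmx_sum_row linear_sum.
  by apply: eq_bigr => s _; rewrite linearZ /= AE.
exists A; split=> // w; apply/aug_exact; rewrite E.
by apply/aug_exact; exists w.
Qed.

(** The comparison maps A : F -> G and B : G -> F and the homotopy h from A B to
the identity are constructed together.  The induction carries only the
consequence D h D = D (A B - 1) of the homotopy equation; it involves a single
homological degree and suffices to lift A' B' - 1 - D h through the next
differential. *)
Lemma comparison (F G : min_free_resolution gr) i :
  exists (A : 'M[R]_(rk F i, rk G i)) (B : 'M[R]_(rk G i, rk F i)),
   [/\ graded_mx (sh F i) (sh G i) A,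
       graded_mx (sh G i) (sh F i) B
     & const_mx0 A *m const_mx0 B = 1%:M].
Proof.
suff [A [B [[gA _] [gB _] AB _]]] :
  exists (A : 'M[R]_(rk F i, rk G i)) (B : 'M[R]_(rk G i, rk F i)),
   [/\ graded_mx (sh F i) (sh G i) A /\
         (forall w, exists w', diff G i w' = diff F i w *m A),
       graded_mx (sh G i) (sh F i) B /\
         (forall w, exists w', diff F i w' = diff G i w *m B),
       const_mx0 A *m const_mx0 B = 1%:M
     & exists h, D F i *m h *m D F i = D F i *m (A *m B - 1%:M)].
  by exists A, B.
elim: i => [|i [A [B [[gA bA] [gB bB] _ [h hE]]]]].
  have [A [gA AE bA]] := chain_map_base F G.
  have [B [gB BE bB]] := chain_map_base G F.
  have [s|h hE] := @matrix_lift _ _ _ (diff F 0) (A *m B - 1%:M).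
    apply/aug_exact; rewrite rowE mulmxBr raddfB /= mulmxA BE AE mulmx1.
    by rewrite subrr.
  exists A, B; split=> //; last by exists h; rewrite -mulmxA hE.
  (* A B - 1 = h D, and D has no constant terms. *)
  apply/eqP; rewrite -subr_eq0 -map_mxM -const_mx0_1 -map_mxB -hE.
  by rewrite map_mxM diff_const0 mulmx0.
have [A' [gA' AE bA']] := chain_map_step gA bA.
have [B' [gB' BE bB']] := chain_map_step gB bB.
have XE : (A' *m B' - 1%:M) *m D F i = D F i *m (A *m B - 1%:M).
  by rewrite mulmxBl mulmxBr mulmx1 mul1mx -mulmxA BE mulmxA AE mulmxA.
have [|h' h'E] := @kernel_lift F i _ (A' *m B' - 1%:M - D F i *m h).
  by rewrite mulmxBl XE hE subrr.
exists A', B'; split=> //; last first.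
  exists h'; rewrite -mulmxA h'E mulmxBr mulmxA diff_sq0 mul0mx subr0 //.
(* A' B' - 1 = h' D' + D h, and neither differential has constant terms. *)
apply/eqP; rewrite -subr_eq0 -map_mxM -const_mx0_1 -map_mxB.
rewrite -[X in const_mx0 X](subrK (D F i *m h)) -h'E map_mxD !map_mxM.
by rewrite !diff_const0 mulmx0 mul0mx addr0.
Qed.

(** Restricting the constant terms of A and B to generators of degree j gives a
factorization of an identity matrix, which bounds its size. *)
Lemma res_betti_le (F G : min_free_resolution gr) i j :
  (res_betti F i j <= res_betti G i j)%N.
Proof.
have [A [B [gA gB AB]]] := comparison F G i.
rewrite /res_betti; set S := [set t | _]; set S' := [set t | _].
pose A' := \matrix_(x < #|S|, y < #|S'|) const_mx0 A (enum_val x) (enum_val y).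
pose B' := \matrix_(y < #|S'|, x < #|S|) const_mx0 B (enum_val y) (enum_val x).
apply: (@mulmx1_min _ _ _ A' B'); apply/matrixP => x y; rewrite mxE.
under eq_bigr do rewrite !mxE.
rewrite -(big_enum_val (fun t => (A (enum_val x) t)@_0%MM * (B t (enum_val y))@_0%MM)).
have /matrixP/(_ (enum_val x) (enum_val y)) := AB.
rewrite !mxE (inj_eq enum_val_inj) => <-.
rewrite [RHS](bigID (mem S')) /= [X in _ = _ + X]big1 ?addr0.
  by apply: eq_bigr => t _; rewrite !mxE.
move=> t; rewrite inE => tj; rewrite (const_mx0_graded gA) ?mul0r //.
have := enum_valP x; rewrite inE => /eqP ->; by rewrite eq_sym.
Qed.

Lemma res_betti_unique (F G : min_free_resolution gr) i j :
  res_betti F i j = res_betti G i j.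
Proof. by apply/eqP; rewrite eqn_leq !res_betti_le. Qed.

(** The Betti numbers are chosen by an epsilon; the existence of F makes the
choice meaningful, and uniqueness makes it irrelevant. *)
Lemma bettiE (F : min_free_resolution gr) i j : betti gr i j = res_betti F i j.
Proof.
pose P b := exists G : min_free_resolution gr, forall i j, b i j = res_betti G i j.
suff [G ->] : P (betti gr) by exact: res_betti_unique.
by apply: (ClassicalEpsilon.epsilon_spec _ P); exists (res_betti F), F.
Qed.

End Compare.
End Graded.

(** * Appending one generator to an ideal *)

Section IdealRcons.
Variable R : comNzRingType.
Implicit Types (s : seq R) (g r : R).

(** Coefficients indexed by natural numbers free membership from the dependency
of the index type on the size of the list of generators. *)
Lemma mem_ideal_nat s r :
  r \in ideal s <-> exists c : nat -> R, r = \sum_(0 <= i < size s) c i * s`_i.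
Proof.
split=> [/idealP[c ->]|[c ->]]; last first.
  by apply/idealP; exists c; rewrite big_mkord.
exists (fun i => if insub i is Some j then c j else 0).
by rewrite big_mkord; apply: eq_bigr => i _; rewrite valK.
Qed.

Lemma mem_ideal_rcons s g r :
  r \in ideal (rcons s g) <-> exists b, r - b * g \in ideal s.
Proof.
have E c : \sum_(0 <= i < size s) c i * (rcons s g)`_i =
    \sum_(0 <= i < size s) c i * s`_i.
  by rewrite !big_nat; apply: eq_bigr => i /andP[_ ilt]; rewrite nth_rcons ilt.
split=> [/mem_ideal_nat[c ->]|[b /mem_ideal_nat[c rE]]].
  exists (c (size s)); apply/mem_ideal_nat; exists c.
  rewrite size_rcons big_nat_recr //= nth_rcons ltnn eqxx addrK; exact: E.
apply/mem_ideal_nat; exists (fun i => if i == size s then b else c i).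
rewrite size_rcons big_nat_recr //= nth_rcons ltnn eqxx.
rewrite -[LHS](subrK (b * g)) rE; congr (_ + _); rewrite -E.
by rewrite !big_nat; apply: eq_bigr => i /andP[_ ilt]; rewrite ltn_eqF.
Qed.

Lemma ideal_rcons_sub s g r : r \in ideal s -> r \in ideal (rcons s g).
Proof. by move=> rs; apply/mem_ideal_rcons; exists 0; rewrite mul0r subr0. Qed.

Lemma ideal_rcons_last s g : g \in ideal (rcons s g).
Proof.
apply/mem_ideal_rcons; exists 1; rewrite mul1r subrr; exact: (rpred0 (ideal_zmod s)).
Qed.

Lemma regular_rcons s g : regular_sequence (rcons s g) ->
  regular_sequence s /\ (forall x : quo s, g *: x = 0 -> x = 0).
Proof.
move=> [reg one]; split; first split.
- move=> i ilt; have := reg i; rewrite size_rcons ltnS (ltnW ilt) nth_rcons ilt.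
  by rewrite -cats1 takel_cat ?(ltnW ilt) //; exact.
- by apply: contra one; exact: ideal_rcons_sub.
have := reg (size s); rewrite size_rcons leqnn nth_rcons ltnn eqxx.
by rewrite -cats1 takel_cat // take_size; exact.
Qed.

Definition quo_rcons s g (x : quo s) : quo (rcons s g) :=
  quo_pi (rcons s g) (repr x).

Lemma quo_rcons_pi s g r : quo_rcons g (quo_pi s r) = quo_pi (rcons s g) r.
Proof.
by apply/quo_piP/ideal_rcons_sub/quo_piP; rewrite quo_piK.
Qed.

Lemma quo_rcons_linear s g : linear (@quo_rcons s g).
Proof.
move=> a x y; rewrite -[x]quo_piK -[y]quo_piK.
rewrite -[a *: quo_pi s _]/(quo_scale _ _) quo_scale_pi -raddfD !quo_rcons_pi.
by rewrite raddfD /= -quo_scale_pi.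
Qed.

HB.instance Definition _ s g :=
  GRing.isLinear.Build R (quo s) (quo (rcons s g)) *:%R (@quo_rcons s g)
    (@quo_rcons_linear s g).

Lemma quo_rcons_eq0 s g (x : quo s) :
  quo_rcons g x = 0 <-> exists y, x = g *: y.
Proof.
rewrite -[x]quo_piK quo_rcons_pi; set r := repr x; split=> [|[y E]].
  rewrite -(raddf0 (quo_pi (rcons s g))) => /quo_piP; rewrite subr0.
  move=> /mem_ideal_rcons[b rb]; exists (quo_pi s b).
  rewrite -[RHS]/(quo_scale _ _) quo_scale_pi mulrC; exact/quo_piP.
rewrite -quo_rcons_pi E -[y]quo_piK -[g *: _]/(quo_scale _ _) quo_scale_pi.
rewrite quo_rcons_pi -(raddf0 (quo_pi (rcons s g))); apply/quo_piP.
by rewrite subr0 mulrC; apply: idealMl; exact: ideal_rcons_last.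
Qed.

End IdealRcons.

(** * The Koszul resolution as an iterated mapping cone *)

(** The number of sets of i positions in T whose entries sum to j, sorted
according to whether they use the head of the list. *)
Fixpoint subset_count (T : seq nat) (i : nat) (j : int) : nat :=
  if T is a :: T' then
    (subset_count T' i j +
     (if i is i'.+1 then subset_count T' i' (j - a%:Z) else 0))%N
  else ((i == 0) && (j == 0))%N.

Section Koszul.
Variables (k : fieldType) (n : nat).
Local Notation R := {mpoly k[n]}.

Lemma max_idealD (r u : R) :
  r \in @max_ideal k n -> u \in @max_ideal k n -> r + u \in @max_ideal k n.
Proof. exact: (@rpredD _ (ideal_zmod _)). Qed.

Lemma max_idealN (r : R) : r \in @max_ideal k n -> - r \in @max_ideal k n.
Proof. by move=> rm; rewrite (@rpredN _ (ideal_zmod _)). Qed.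

Lemma coeff0_max_ideal (r : R) : r@_0%MM = 0 -> r \in @max_ideal k n.
Proof.
move=> r0; rewrite (mpolyE r).
apply: (big_ind (fun u : R => u \in @max_ideal k n)).
- exact: (rpred0 (ideal_zmod _)).
- exact: max_idealD.
move=> m _; have [->|m0] := eqVneq m 0%MM.
  by rewrite r0 scale0r; exact: (rpred0 (ideal_zmod _)).
have [i mi] : exists i, (0 < m i)%N.
  apply/existsP; apply: contraNT m0 => /existsPn m0.
  by apply/eqP/mnmP => i; rewrite mnm0E; apply/eqP; rewrite -leqn0 leqNgt.
have -> : m = (m - U_(i) + U_(i))%MM.
  by rewrite submK //; apply/mnm_lepP => j; rewrite mnm1E; case: eqP => // <-.
rewrite mpolyXD -mul_mpolyC mulrA; apply: idealMl; apply/mem_ideal_nat.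
exists (fun l => (l == val i)%:R); rewrite size_map size_enum_ord.
rewrite (bigD1_seq (val i)) ?mem_index_iota ?iota_uniq //= ?index_iota ?ltn_ord //.
rewrite eqxx mul1r (nth_map i) ?size_enum_ord // nth_ord_enum.
by rewrite big1 ?addr0 // => l /negbTE ->; rewrite mul0r.
Qed.

Lemma homog0_const (r : R) : r \is 0.-homog -> r = (r@_0%MM)%:MP.
Proof.
move=> r0; apply/mpolyP => m; rewrite mcoeffC; have [->|m0] := eqVneq m 0%MM.
  by rewrite mulr1.
by rewrite mulr0; apply: (dhomog_nemf_coeff r0); rewrite /= mdeg_eq0.
Qed.

Section Cone.
Variables (s : seq R) (g : R) (e : nat).
Hypothesis g_homog : g \is e.-homog.
Hypothesis g_coeff0 : g@_0%MM = 0.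
Hypothesis g_regular : forall x : quo s, g *: x = 0 -> x = 0.
Variable F : min_free_resolution (@quo_gr k n s).

(** The cone of multiplication by g : F(-e) -> F. *)
Definition cone_rk (i : nat) : nat :=
  if i is i'.+1 then (rk F i'.+1 + rk F i')%N else rk F 0.

Definition cone_shift (i : nat) : 'I_(cone_rk i) -> int :=
  match i with
  | 0 => @shift _ _ _ _ F 0
  | i'.+1 => fun t : 'I_(rk F i'.+1 + rk F i') =>
      match split t with
      | inl u => shift u
      | inr u => shift u + e%:Z
      end
  end.

Definition cone_diff (i : nat) : 'rV[R]_(cone_rk i.+1) -> 'rV[R]_(cone_rk i) :=
  match i with
  | 0 => fun v : 'rV_(rk F 1 + rk F 0) =>
      diff F 0 (lsubmx v) + g *: rsubmx v
  | i'.+1 => fun v : 'rV_(rk F i'.+2 + rk F i'.+1) =>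
      row_mx (diff F i'.+1 (lsubmx v) + g *: rsubmx v) (- diff F i' (rsubmx v))
  end.

Lemma cone_diff_linear i : linear (@cone_diff i).
Proof.
case: i => [|i] b v w /=; rewrite !linearP /=; last first.
  rewrite scale_row_mx add_row_mx scalerN; congr row_mx.
  by rewrite scalerDr addrACA.
by rewrite scalerDr addrACA.
Qed.

HB.instance Definition _ i :=
  GRing.isLinear.Build R _ _ *:%R (@cone_diff i) (@cone_diff_linear i).

Definition cone_aug (v : 'rV[R]_(cone_rk 0)) : quo (rcons s g) :=
  quo_rcons g (aug F v).

Lemma cone_aug_linear : linear cone_aug.
Proof. by move=> b v w; rewrite /cone_aug !linearP. Qed.

HB.instance Definition _ :=
  GRing.isLinear.Build R _ _ *:%R cone_aug cone_aug_linear.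

Lemma free_gr_cone i j (v : 'rV[R]_(rk F i.+1 + rk F i)) :
  free_gr (@cone_shift i.+1) j v <->
  free_gr (@shift _ _ _ _ F i.+1) j (lsubmx v) /\
  free_gr (@shift _ _ _ _ F i) (j - e%:Z) (rsubmx v).
Proof.
have sl u : cone_shift (i := i.+1) (lshift (rk F i) u) = shift u.
  by rewrite /= (unsplitK (inl u)).
have sr u : cone_shift (i := i.+1) (rshift (rk F i.+1) u) = shift u + e%:Z.
  by rewrite /= (unsplitK (inr u)).
split=> [gv|[gl gr] t].
  split=> t; [have := gv (lshift _ t)|have := gv (rshift _ t)].
    by rewrite sl mxE.
  by rewrite sr mxE opprD addrCA addrC.
rewrite -[t]splitK; case: (split t) => u /=.
  by have := gl u; rewrite -sl mxE.
by have := gr u; rewrite mxE -addrA -opprD (addrC _ (shift u)) -sr.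
Qed.

Lemma free_grD m (b : 'I_m -> int) j (v w : 'rV[R]_m) :
  free_gr b j v -> free_gr b j w -> free_gr b j (v + w).
Proof. by move=> gv gw t; rewrite mxE; exact: poly_grD. Qed.

Lemma free_gr_scale m (b : 'I_m -> int) j (v : 'rV[R]_m) :
  free_gr b (j - e%:Z) v -> free_gr b j (g *: v).
Proof.
move=> gv t; rewrite mxE; have -> : j - b t = e%:Z + (j - e%:Z - b t) by ring.
exact: poly_grM (gv t).
Qed.

Lemma cone_diff_gr i j v : free_gr (@cone_shift i.+1) j v ->
  free_gr (@cone_shift i) j (cone_diff v).
Proof.
move=> /free_gr_cone[gl gr]; case: i v gl gr => [|i] v gl gr.
  exact: free_grD (diff_gr gl) (free_gr_scale gr).
apply/free_gr_cone; rewrite row_mxKl row_mxKr; split.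
  exact: free_grD (diff_gr gl) (free_gr_scale gr).
by move=> t; rewrite mxE; apply/poly_grN/diff_gr.
Qed.

Lemma cone_diff_min i (v : 'rV[R]_(cone_rk i.+1)) t :
  cone_diff v 0 t \in @max_ideal k n.
Proof.
have gm m (w : 'rV[R]_m) u : (g *: w) 0 u \in @max_ideal k n.
  by rewrite mxE mulrC; apply/idealMl/coeff0_max_ideal.
case: i v t => [|i] v t.
  by rewrite mxE; apply: max_idealD (gm _ _ _); exact: diff_min.
rewrite /= -[t]splitK; case: (split t) => u /=.
  by rewrite row_mxEl mxE; apply: max_idealD (gm _ _ _); exact: diff_min.
by rewrite row_mxEr mxE; apply/max_idealN/diff_min.
Qed.

Lemma cone_aug_surj x : exists v, cone_aug v = x.
Proof.
have [v vx] := aug_surj F (quo_pi s (repr x)); exists v.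
by rewrite /cone_aug vx quo_rcons_pi quo_piK.
Qed.

Lemma cone_aug_exact v : cone_aug v = 0 <-> exists w, cone_diff (i := 0) w = v.
Proof.
split=> [/quo_rcons_eq0[y]|[w <-]]; last first.
  apply/quo_rcons_eq0; exists (aug F (rsubmx w)); rewrite linearD linearZ /=.
  have -> : aug F (diff F 0 (lsubmx w)) = 0 by apply/aug_exact; exists (lsubmx w).
  by rewrite add0r.
have [u <-] := aug_surj F y => vE.
have /aug_exact[x xE] : aug F (v - g *: u) = 0.
  by rewrite linearB linearZ /= vE subrr.
by exists (row_mx x u); rewrite /= row_mxKl row_mxKr xE subrK.
Qed.

Lemma diffK i v : diff F i (diff F i.+1 v) = 0.
Proof. by apply/diff_exact; exists v. Qed.

Lemma cone_diff_exact i v :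
  cone_diff (i := i) v = 0 <-> exists w, cone_diff (i := i.+1) w = v.
Proof.
case: i v => [|i] v; split.
- (* If (x, y) is a cycle then g kills the class of y, so y is a boundary. *)
  rewrite /= => v0; have /aug_exact[y yE] : aug F (rsubmx v) = 0.
    apply: g_regular; move/(congr1 (aug F)): v0.
    rewrite raddf0 linearD linearZ /=.
    have -> : aug F (diff F 0 (lsubmx v)) = 0.
      by apply/aug_exact; exists (lsubmx v).
    by rewrite add0r.
  have /diff_exact[x xE] : diff F 0 (lsubmx v + g *: y) = 0.
    by rewrite linearD linearZ /= yE.
  exists (row_mx x (- y)); rewrite row_mxKl row_mxKr xE scalerN addrK linearN.
  by rewrite opprK yE hsubmxK.
- case=> w <- /=; rewrite row_mxKl row_mxKr linearD linearZ diffK add0r /=.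
  by rewrite scalerN subrr.
- rewrite /= -(row_mx0 R 1 (rk F i.+1) (rk F i)) => /eq_row_mx[xE /eqP].
  rewrite oppr_eq0 => /eqP /diff_exact[y yE].
  have /diff_exact[x {}xE] : diff F i.+1 (lsubmx v + g *: y) = 0.
    by rewrite linearD linearZ /= yE.
  exists (row_mx x (- y)); rewrite row_mxKl row_mxKr xE scalerN addrK linearN.
  by rewrite opprK yE hsubmxK.
case=> w <- /=; rewrite !row_mxKl !row_mxKr linearD linearZ !linearN diffK add0r /=.
by rewrite subrr diffK !oppr0 row_mx0.
Qed.

Lemma cone_rk_finite : exists l, forall i, (l < i)%N -> cone_rk i = 0%N.
Proof.
have [l lE] := rk_finite F; exists l.+1 => -[|i] //= li.
by rewrite !lE // ltnW.
Qed.

Lemma cone_aug_gr j v : free_gr (@cone_shift 0) j v -> quo_gr j (cone_aug v).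
Proof.
move=> gv; have [r gr_r rE] := @aug_gr _ _ _ _ F j v gv.
by exists r; rewrite // /cone_aug rE quo_rcons_pi.
Qed.

Definition cone : min_free_resolution (@quo_gr k n (rcons s g)) :=
  @Build_min_free_resolution k n _ _ cone_rk cone_shift
    (fun i => @cone_diff i : {linear _ -> _}) (cone_aug : {linear _ -> _})
    cone_rk_finite cone_diff_gr cone_aug_gr cone_aug_surj
    cone_aug_exact cone_diff_exact cone_diff_min.

Lemma res_betti_cone0 j : res_betti cone 0 j = res_betti F 0 j.
Proof. by []. Qed.

Lemma res_betti_coneS i j :
  res_betti cone i.+1 j = (res_betti F i.+1 j + res_betti F i (j - e%:Z)%R)%N.
Proof.
rewrite /res_betti -!sum1_card big_mkcond big_split_ord /=.
congr (_ + _)%N; rewrite [RHS]big_mkcond; apply: eq_bigr => u _; rewrite !inE.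
  by rewrite (unsplitK (inl u)).
by rewrite (unsplitK (inr u)) eq_sym -subr_eq eq_sym.
Qed.

End Cone.

Definition unit_rk (i : nat) : nat := if i is 0 then 1 else 0.

Definition unit_aug (v : 'rV[R]_1) : quo ([::] : seq R) := quo_pi [::] (v 0 0).

Lemma unit_aug_linear : linear unit_aug.
Proof.
move=> b v w; rewrite /unit_aug !mxE raddfD /=; congr (_ + _).
by rewrite -quo_scale_pi.
Qed.

HB.instance Definition _ :=
  GRing.isLinear.Build R _ _ *:%R unit_aug unit_aug_linear.

Definition unit_diff (i : nat) : {linear 'rV[R]_(unit_rk i.+1) -> 'rV[R]_(unit_rk i)} :=
  \0.

Lemma unit_resolution :
  exists F : min_free_resolution (@quo_gr k n [::]),
    forall i j, res_betti F i j = ((i == 0) && (j == 0))%N.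
Proof.
have ex : exists l, forall i, (l < i)%N -> unit_rk i = 0%N by exists 0%N => -[].
have dgr i j v : free_gr (fun _ : 'I_(unit_rk i.+1) => 0) j v ->
    free_gr (fun _ : 'I_(unit_rk i) => 0) j (unit_diff i v).
  by move=> _ t; rewrite mxE; exact: poly_gr0.
have agr j v : free_gr (fun _ : 'I_(unit_rk 0) => 0) j v ->
    @quo_gr k n [::] j (unit_aug v).
  by move=> gv; exists (v 0 0) => //; have := gv 0; rewrite subr0.
have asurj x : exists v, unit_aug v = x.
  by exists (const_mx (repr x)); rewrite /unit_aug mxE quo_piK.
have aex v : unit_aug v = 0 <-> exists w, unit_diff 0 w = v.
  split=> [|[w <-]]; last by rewrite raddf0.
  rewrite /unit_aug -(raddf0 (quo_pi [::])) => /quo_piP; rewrite subr0.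
  case/idealP => c; rewrite big_ord0 => v0; exists 0; apply/rowP => t.
  by rewrite ord1 v0 mxE.
have dex i v : unit_diff i v = 0 <-> exists w, unit_diff i.+1 w = v.
  by split=> // _; exists 0; rewrite [v]thinmx0 raddf0.
have dmin i v t : unit_diff i v 0 t \in @max_ideal k n.
  by rewrite mxE; exact: (rpred0 (ideal_zmod _)).
exists (@Build_min_free_resolution k n _ _ unit_rk _ unit_diff
  (unit_aug : {linear _ -> _}) ex dgr agr asurj aex dex dmin) => i j.
rewrite /res_betti -sum1_card big_mkcond.
case: i => [|i]; last by rewrite big_ord0.
by rewrite big_ord1 inE eq_sym; case: eqP.
Qed.

(** A constant g is excluded: if it is invertible the ideal is the whole ring,
and if it is zero it can be regular only on the zero module. *)
Lemma regular_degree (s : seq R) (g : R) d :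
  regular_sequence (rcons s g) -> g \is d.-homog -> (0 < d)%N.
Proof.
move=> reg; case: d => // g0; have [_ gr] := regular_rcons reg.
case: reg => _ /negP one; case: one.
rewrite (homog0_const g0) in gr *; set c := g@_0%MM in gr *.
have [c0|c0] := eqVneq c 0.
  apply: ideal_rcons_sub; rewrite -[1]subr0; apply/quo_piP; rewrite raddf0.
  apply: gr; rewrite c0 scale0r //.
have -> : 1 = (c^-1)%:MP * c%:MP :> R by rewrite -mpolyCM mulVf // mpolyC1.
by apply: idealMl; exact: ideal_rcons_last.
Qed.

Lemma koszul_resolution (s : seq R) :
  {in s, forall g, g \is homog mdeg} -> regular_sequence s ->
  exists T : seq nat, [/\ size T = size s, all (ltn 0) T
    & exists F : min_free_resolution (@quo_gr k n s),
        forall i j, res_betti F i j = subset_count T i j].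
Proof.
elim/last_ind: s => [|s g IH] hs reg.
  by exists [::]; split=> //; exact: unit_resolution.
have [regs gr] := regular_rcons reg.
have [|T [sT T0 [F FE]]] := IH _ regs.
  by move=> h hs'; apply: hs; rewrite mem_rcons inE hs' orbT.
have /homogP[d gd] : g \is homog mdeg by apply: hs; rewrite mem_rcons mem_head.
have d0 := regular_degree reg gd.
have g0 : g@_0%MM = 0.
  by apply: (dhomog_nemf_coeff gd); rewrite /= mdeg0 ltn_eqF.
exists (d :: T); split; first by rewrite /= sT size_rcons.
  by rewrite /= d0.
exists (cone gd g0 gr F) => -[|i] j; rewrite ?res_betti_cone0 ?res_betti_coneS !FE //=.
by rewrite addn0.
Qed.

End Koszul.

(** * Summing pure diagrams over the orderings of the degrees *)

(** Any entry, not only the head, can be used to sort the subsets. *)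
Lemma subset_count_rem (T : seq nat) (x : nat) : x \in T ->
  forall i j, subset_count T i j = subset_count (x :: rem x T) i j.
Proof.
elim: T => [//|b T IH]; rewrite inE /= => + i j.
have [->//|nbx] := eqVneq b x.
move=> xT; rewrite !IH // {nbx}.
case: i => [|[|i]] /=; rewrite ?IH //= ?addn0.
- by rewrite addnAC.
by rewrite (addrAC j (- b%:Z)); ring.
Qed.

Lemma subset_count0 (T : seq nat) j : subset_count T 0 j = (j == 0).
Proof. by elim: T => //= a T ->; rewrite addn0. Qed.

Lemma subset_count_big (T : seq nat) i j :
  (size T < i)%N -> subset_count T i j = 0%N.
Proof.
elim: T i j => [|a T IH] [|i] j //= h.
by rewrite !IH // (ltn_trans _ h).
Qed.

Lemma subset_count_le0 (T : seq nat) i j :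
  all (ltn 0) T -> j <= 0 -> subset_count T i.+1 j = 0%N.
Proof.
move=> + j0; elim: T i j j0 => [|a T IH] i j j0 //= /andP[a0 T0].
rewrite IH // add0n; case: i => [|i].
  by rewrite subset_count0; case: eqP => //; lia.
by rewrite IH //; lia.
Qed.

(** Both sides count the pairs (S, x) with x outside S, weighted by the degree
x: the entries outside S sum to sumn T - j. *)
Lemma sum_weight_out (T : seq nat) (i : nat) (j : int) :
  \sum_(x <- T) x%:R * (subset_count (rem x T) i j)%:R
  = ((sumn T)%:Z - j)%:~R * (subset_count T i j)%:R :> rat.
Proof.
elim: T i j => [|b T IH] i j.
  rewrite big_nil /=; case: eqP => _ /=; rewrite ?mulr0 //.
  by case: (eqVneq j 0) => [->|]; rewrite ?subrr ?mul0r ?mulr0.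
rewrite big_cons /= eqxx.
have -> : \sum_(x <- T) x%:R *
    (subset_count (if b == x then T else b :: rem x T) i j)%:R
  = \sum_(x <- T) (x%:R * (subset_count (rem x T) i j)%:R
     + x%:R * (if i is i'.+1 then subset_count (rem x T) i' (j - b%:Z) else 0)%:R)
     :> rat.
  rewrite !big_seq; apply: eq_bigr => x xT; rewrite -mulrDr -natrD.
  case: eqP => [->|//]; by rewrite (subset_count_rem xT).
rewrite big_split /= IH; case: i => [|i].
  rewrite big1 => [|x _]; last by rewrite mulr0.
  rewrite addr0 addn0 subset_count0.
  by case: (eqVneq j 0) => [->|]; rewrite ?mulr0 ?addr0 // PoszD; ring.
by rewrite IH PoszD !natrD; ring.
Qed.

(** The same double count for x inside S; the entries of S sum to j. *)
Lemma sum_weight_in (T : seq nat) (i : nat) (j : int) :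
  \sum_(x <- T) x%:R * (subset_count (rem x T) i (j - x%:Z))%:R
  = j%:~R * (subset_count T i.+1 j)%:R :> rat.
Proof.
have E x : x \in T -> x%:R * (subset_count (rem x T) i (j - x%:Z))%:R
    = x%:R * (subset_count T i.+1 j)%:R
      - x%:R * (subset_count (rem x T) i.+1 j)%:R :> rat.
  by move=> xT; rewrite (subset_count_rem xT i.+1 j) /= natrD; ring.
rewrite big_seq (eq_bigr _ E) -big_seq sumrB sum_weight_out -mulr_suml.
by rewrite -natr_sum -sumnE; ring.
Qed.

(** Equal degrees are treated as distinct letters: a list of size p has exactly
p! orderings, with repetitions.  The fuel n is meant to be the size of T. *)
Fixpoint orderings_rec (n : nat) (T : seq nat) : seq (seq nat) :=
  if n is n'.+1 then
    flatten [seq [seq x :: w | w <- orderings_rec n' (rem x T)] | x <- T]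
  else [:: [::]].

Definition orderings (T : seq nat) := orderings_rec (size T) T.

Lemma perm_orderings T w : w \in orderings T -> perm_eq w T.
Proof.
rewrite /orderings; move sT: (size T) => n; elim: n T sT w => [|n IH] T.
  by move/size0nil => -> w /=; rewrite inE => /eqP ->.
move=> sT w /flatten_mapP[x xT /mapP[v vw ->]].
rewrite (permPr (perm_to_rem xT)) perm_cons; apply: IH vw.
by rewrite size_rem // sT.
Qed.

Lemma sum_orderings_first n T (F : seq nat -> rat) :
  \sum_(w <- orderings_rec n.+1 T) F w =
  \sum_(x <- T) \sum_(w <- orderings_rec n (rem x T)) F (x :: w).
Proof. by rewrite /= big_flatten big_map; apply: eq_bigr => x _; rewrite big_map. Qed.

Lemma rem_rem (T : seq nat) x y : rem x (rem y T) = rem y (rem x T).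
Proof.
elim: T => //= b T IH.
have [eby|nby] := eqVneq b y; have [ebx|nbx] := eqVneq b x => //=.
- by rewrite -ebx -eby.
- by rewrite eby eqxx.
- by rewrite ebx eqxx.
- by rewrite (negbTE nbx) (negbTE nby) IH.
Qed.

Lemma sum_rem (T : seq nat) x (F : nat -> rat) : x \in T ->
  \sum_(y <- rem x T) F y = \sum_(y <- T) F y - F x.
Proof. by move=> xT; rewrite (perm_big _ (perm_to_rem xT)) big_cons addrC addKr. Qed.

Lemma exchange_rem (T : seq nat) (G : nat -> nat -> rat) :
  \sum_(x <- T) \sum_(y <- rem x T) G x y =
  \sum_(x <- T) \sum_(y <- rem x T) G y x.
Proof.
have E H : \sum_(x <- T) \sum_(y <- rem x T) H x y =
    \sum_(x <- T) \sum_(y <- T) H x y - \sum_(x <- T) H x x :> rat.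
  by rewrite -sumrB !big_seq; apply: eq_bigr => x xT; rewrite sum_rem.
by rewrite !E exchange_big.
Qed.

(** Induction exposes the last letter of what follows the first letter, and the
choices of a first and of a last letter commute. *)
Lemma sum_orderings_last n T (F : seq nat -> rat) : size T = n.+1 ->
  \sum_(w <- orderings_rec n.+1 T) F w =
  \sum_(x <- T) \sum_(w <- orderings_rec n (rem x T)) F (rcons w x).
Proof.
elim: n T F => [|n IH] T F sT; rewrite sum_orderings_first.
  by apply: eq_bigr => x _; rewrite !big_seq1.
transitivity (\sum_(x <- T) \sum_(y <- rem x T)
   \sum_(w <- orderings_rec n (rem y (rem x T))) F (x :: rcons w y)).
  rewrite !big_seq; apply: eq_bigr => x xT.
  by rewrite (IH (rem x T) (fun w => F (x :: w))) // size_rem // sT.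
rewrite exchange_rem; apply: eq_bigr => x _.
rewrite sum_orderings_first; apply: eq_bigr => y _.
by rewrite rem_rem.
Qed.

Definition prefix_sum (w : seq nat) (b : nat) : int := (sumn (take b w))%:Z.

(** The rescaled pure diagram of the degree sequence of initial sums of w.  For
positive letters the sign makes the entries positive, as i of the factors are
negative. *)
Definition chain_weight (w : seq nat) (i : nat) (j : int) : rat :=
  (j == prefix_sum w i)%:R * (-1) ^+ i *
  \prod_(b < (size w).+1 | b != i :> nat) (prefix_sum w b - prefix_sum w i)%:~R^-1.

Lemma prefix_sum_cons x w b : prefix_sum (x :: w) b.+1 = x%:Z + prefix_sum w b.
Proof. by rewrite /prefix_sum /= PoszD. Qed.

(** The factors are differences of initial sums, which a common translation by x
does not change; the one new initial sum, 0, contributes the factor - 1 / j. *)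
Lemma chain_weight_cons x w i j :
  chain_weight (x :: w) i.+1 j = chain_weight w i (j - x%:Z) / j%:~R.
Proof.
rewrite /chain_weight prefix_sum_cons subr_eq (addrC (prefix_sum w i)).
case: eqP => [->|]; last by rewrite !mul0r.
rewrite !mul1r [in LHS]big_mkcond big_ord_recl /= {1}/prefix_sum take0 /=.
rewrite sub0r rmorphN invrN mulrA exprS mulN1r mulrNN -!mulrA; congr *%R.
rewrite mulrC [in RHS]big_mkcond; congr (_ / _); apply: eq_bigr => b _.
rewrite /= /bump leq0n add1n eqSS; case: eqP => //= _.
by rewrite prefix_sum_cons opprD addrACA subrr add0r.
Qed.

Lemma prefix_sum_rcons w x b : (b <= size w)%N ->
  prefix_sum (rcons w x) b = prefix_sum w b.
Proof. by move=> bw; rewrite /prefix_sum -cats1 takel_cat. Qed.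

Lemma chain_weight_rcons w x j :
  chain_weight (rcons w x) 0 j = chain_weight w 0 j / (x + sumn w)%:R.
Proof.
rewrite /chain_weight size_rcons /prefix_sum !take0 big_mkcond /=.
rewrite -[RHS]mulrA; congr (_ * _).
rewrite [LHS]big_ord_recr /=; congr (_ * _).
  rewrite [RHS]big_mkcond; apply: eq_bigr => b _; case: eqP => // _.
  by rewrite -/(prefix_sum (rcons w x) b) prefix_sum_rcons // -ltnS ltn_ord.
by rewrite -(size_rcons w x) take_size sumn_rcons subr0 addnC.
Qed.

(** Induction on the size of T.  Row 0 must be treated through last letters, as
deleting a first letter shifts the rows. *)
Lemma sum_chain_weight (T : seq nat) i j : all (ltn 0) T -> (i <= size T)%N ->
  (\prod_(x <- T) x%:R) * \sum_(w <- orderings T) chain_weight w i j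
  = (subset_count T i j)%:R.
Proof.
rewrite /orderings; move sT: (size T) => n; elim: n T sT i j => [|n IH] T.
  move=> /size0nil -> [|i] j _ // _; rewrite big_nil big_seq1.
  by rewrite /chain_weight /prefix_sum /= big_mkcond big_ord1 /= !mulr1 mul1r.
move=> sT i j T0 iT.
have step x i' j' : x \in T -> (i' <= n)%N ->
    (\prod_(y <- T) y%:R) *
      \sum_(w <- orderings_rec n (rem x T)) chain_weight w i' j'
    = x%:R * (subset_count (rem x T) i' j')%:R :> rat.
  move=> xT i'n; rewrite (perm_big _ (perm_to_rem xT)) big_cons -mulrA IH //.
    by rewrite size_rem // sT.
  by apply/allP => y /mem_rem; apply: (allP T0).
case: i iT => [|i] iT.
  rewrite sum_orderings_last // mulr_sumr.
  transitivity (\sum_(x <- T) x%:R * (subset_count (rem x T) 0 j)%:R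
                  / (sumn T)%:R : rat).
    rewrite big_seq [RHS]big_seq; apply: eq_bigr => x xT.
    rewrite -step // -mulrA; congr (_ * _); rewrite mulr_suml !big_seq.
    apply: eq_bigr => w wT; rewrite chain_weight_rcons; congr (_ / _%:R).
    have sr : size (rem x T) = n by rewrite size_rem // sT.
    have := @perm_orderings (rem x T) w; rewrite /orderings sr => /(_ wT) pw.
    by rewrite (perm_sumn pw) (perm_sumn (perm_to_rem xT)).
  rewrite -mulr_suml sum_weight_out subset_count0.
  case: (eqVneq j 0) => [->|_]; last by rewrite !mulr0 mul0r.
  rewrite subr0 mulr1 divff // pnatr_eq0 -lt0n.
  case: (T) sT T0 => //= a T' _ /andP[a0 _]; lia.
rewrite sum_orderings_first mulr_sumr.
transitivity (\sum_(x <- T) x%:R * (subset_count (rem x T) i (j - x%:Z))%:R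
                / j%:~R : rat).
  rewrite big_seq [RHS]big_seq; apply: eq_bigr => x xT.
  rewrite -step // -mulrA mulr_suml; congr (_ * _).
  by apply: eq_bigr => w _; rewrite chain_weight_cons.
rewrite -mulr_suml sum_weight_in.
case: (eqVneq j 0) => [->|j0]; last by rewrite mulrAC divff ?mul1r // intr_eq0.
(* The quotient by j is spurious in column 0, where both sides vanish. *)
by rewrite subset_count_le0 // !mul0r.
Qed.

(** As d_0 = 0, dividing by the product of the other d_b turns the numerators of
the entry in row a > 0 into the missing factor 1 / d_a, up to sign. *)
Lemma pure_diagram_normalized (p : nat) (d : 'I_p.+1 -> int)
    (a : 'I_p.+1) (j : int) : increasing d -> d ord0 = 0 ->
  (\prod_(b : 'I_p.+1 | b != ord0) (d b)%:~R)^-1 * pure_diagram d a j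
  = (j == d a)%:R * (-1) ^+ a * \prod_(b : 'I_p.+1 | b != a) (d b - d a)%:~R^-1.
Proof.
move=> incr d0.
have dpos b : b != ord0 -> (d b)%:~R != 0 :> rat.
  by move=> b0; rewrite intr_eq0 gt_eqF // -d0 incr // lt0n.
rewrite /pure_diagram valK.
case: (eqVneq j (d a)) => [_|_] /=; last by rewrite mulr0 !mul0r.
rewrite mul1r; have [->|a0] := eqVneq a ord0.
  rewrite mulr1 mul1r -prodfV; apply: eq_bigr => b _.
  by rewrite d0 subr0.
rewrite (bigD1 a a0) /= [in RHS](bigD1 ord0) 1?eq_sym //= d0 sub0r.
have eqP2 (F : 'I_p.+1 -> rat) : \prod_(b | (b != a) && (b != ord0)) F b
    = \prod_(b | (b != ord0) && (b != a)) F b.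
  by apply: eq_bigl => b; rewrite andbC.
under [X in (-1) ^+ _.+1 * X]eq_bigr do rewrite subr0.
rewrite !eqP2 big_split /= mulrNz invrN exprS mulN1r.
set D := \prod_(b | _) (d b)%:~R.
have D0 : D != 0 by apply/prodf_neq0 => b /andP[/dpos].
by field; rewrite D0 dpos.
Qed.

Lemma subset_count_pure (p : nat) (T : seq nat) : size T = p -> all (ltn 0) T ->
  exists (N : nat) (c : 'I_N -> rat) (d : 'I_N -> 'I_p.+1 -> int),
    [/\ forall s, 0 <= c s,
        forall s, increasing (d s)
      & forall (i : nat) (j : int),
          (subset_count T i j)%:R = \sum_(s < N) c s * pure_diagram (d s) i j].
Proof.
move=> sT T0; set L := orderings T.
pose d (w : seq nat) (b : 'I_p.+1) := prefix_sum w b.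
pose c (w : seq nat) : rat :=
  (\prod_(x <- T) x%:R) * (\prod_(b : 'I_p.+1 | b != ord0) (d w b)%:~R)^-1.
have LT w : w \in L -> size w = p /\ all (ltn 0) w.
  by move=> /perm_orderings pw; rewrite (perm_size pw) (perm_all _ pw).
have incr w : w \in L -> increasing (d w).
  move=> /LT[sw w0] a b ab; rewrite /d /prefix_sum ltz_nat.
  rewrite -(subnK (ltnW ab)) addnC takeD sumn_cat -[ltnLHS]addn0 ltn_add2l.
  have : (0 < size (take (b - a) (drop a w)))%N.
    rewrite size_take size_drop sw; have := ltn_ord b; case: ifP; lia.
  have : all (ltn 0) (take (b - a) (drop a w)).
    by apply/allP => x /mem_take /mem_drop; apply: (allP w0).
  case: (take _ _) => //= x s /andP[x0 _] _; lia.
exists (size L), (fun s => c (nth [::] L s)), (fun s => d (nth [::] L s)); split.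
- move=> s; apply: mulr_ge0; first by apply: prodr_ge0 => x _; exact: ler0n.
  by rewrite invr_ge0; apply: prodr_ge0 => b _; rewrite ler0z /d /prefix_sum.
- by move=> s; apply/incr/mem_nth.
move=> i j.
rewrite -(big_mkord xpredT
  (fun s => c (nth [::] L s) * pure_diagram (d (nth [::] L s)) i j)).
rewrite -(big_nth [::] xpredT (fun w => c w * pure_diagram (d w) i j)).
case: (leqP i p) => ip; last first.
  rewrite subset_count_big ?sT // big1 // => w _.
  by rewrite /pure_diagram insubN ?mulr0 // -leqNgt.
rewrite -sum_chain_weight ?sT // mulr_sumr big_seq [RHS]big_seq.
apply: eq_bigr => w wL; have [sw w0] := LT w wL.
rewrite -mulrA; congr (_ * _).
have ip' : (i < p.+1)%N by [].
rewrite -[i]/(val (Ordinal ip')) pure_diagram_normalized ?/d; last 2 first.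
- exact: incr.
- by rewrite /prefix_sum take0.
by rewrite /chain_weight sw.
Qed.

Theorem theorem4p3 (k : fieldType) (n p : nat) (f : p.-tuple {mpoly k[n]})
  (f_homog : forall i : 'I_p, tnth f i \is homog mdeg)
  (f_regular : regular_sequence f) :
  exists (N : nat) (c : 'I_N -> rat) (d : 'I_N -> 'I_p.+1 -> int),
    [/\ forall s, 0 <= c s,
        forall s, increasing (d s)
      & forall (i : nat) (j : int),
          (betti (@quo_gr k n f) i j)%:R = \sum_(s < N) c s * pure_diagram (d s) i j].
Proof.
have hf : {in (f : seq _), forall g, g \is homog mdeg}.
  by move=> g /tnthP[i ->]; exact: f_homog.
have [T [sT T0 [F FE]]] := koszul_resolution hf f_regular.
rewrite size_tuple in sT.
have [gr0 _ _ indep] : is_grading (@quo_gr k n f).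
  by apply: quo_grading => i ilt; apply/hf/mem_nth.
have [N [c [d [c0 incr dE]]]] := subset_count_pure sT T0.
exists N, c, d; split=> // i j.
by rewrite (bettiE (conj gr0 indep) F) FE dE.
Qed.
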